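(* Let $d\ge 1$ and $\sigma\in\mathbb{R}$. For every $\alpha\in\mathbb{C}_+\setminus(0,\infty)$, every $\varepsilon\in(0,1]$, every $T>0$, every $\phi_0\in H^\sigma(\mathbb{T}^d)$, $\phi_1\in H^{\sigma-1}(\mathbb{T}^d)$ and $f\in L^2(0,T;H^{\sigma-1}(\mathbb{T}^d))$, the solution $u_{\varepsilon,\alpha}$ of $$\varepsilon^2\partial_t^2u_{\varepsilon,\alpha}+2\alpha\,\partial_tu_{\varepsilon,\alpha}+(1-\Delta)u_{\varepsilon,\alpha}=f\quad (t>0,\ x\in\mathbb{T}^d),\qquad (u_{\varepsilon,\alpha},\varepsilon\partial_tu_{\varepsilon,\alpha})|_{t=0}=(\phi_0,\phi_1)$$ satisfies $$\|(u_{\varepsilon,\alpha},\varepsilon\partial_tu_{\varepsilon,\alpha})\|_{L^\infty(0,T;\mathcal{H}^\sigma(\mathbb{T}^d))}\le C_\alpha\Big(\|\phi_0\|_{H^\sigma(\mathbb{T}^d)}+\|\phi_1\|_{H^{\sigma-1}(\mathbb{T}^d)}+\|f\|_{L^2(0,T;H^{\sigma-1}(\mathbb{T}^d))}\Big),$$ where the constant $C_\alpha$ does not depend on $\varepsilon$, $T$, $\phi_0,\phi_1,f$, and $\alpha\mapsto C_\alpha$ is a locally bounded function of $\alpha\in\mathbb{C}_+\setminus(0,\infty)$.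
   Context: $\mathbb{T}^d=(\mathbb{R}/2\pi\mathbb{Z})^d$; all functions are complex-valued. $\mathbb{C}_+=\{\alpha\in\mathbb{C}:\mathrm{Re}(\alpha)>0\}$, so $\mathbb{C}_+\setminus(0,\infty)=\{\alpha\in\mathbb{C}_+:\mathrm{Im}(\alpha)\ne0\}$. With $e_k(x)=(2\pi)^{-d/2}e^{ik\cdot x}$, $\hat f(k)=\int_{\mathbb{T}^d} f\,\overline{e_k}\,dx$, $\langle k\rangle=\sqrt{1+|k|^2}$, the Sobolev norm is $\|f\|_{H^s}=\big(\sum_{k\in\mathbb{Z}^d}\langle k\rangle^{2s}|\hat f(k)|^2\big)^{1/2}$, and $\mathcal{H}^s=H^s\times H^{s-1}$. For $\varphi:\mathbb{Z}^d\to\mathbb{C}$, $\varphi(\nabla)f=\sum_k\varphi(k)\hat f(k)e_k$. The square root is $\sqrt{re^{i\theta}}=\sqrt r\,e^{i\theta/2}$ for $r\ge 0$, $\theta\in(-\pi,\pi]$. The solution is understood in the mild form $$u_{\varepsilon,\alpha}(t)=\sum_{\pm}e^{t\lambda^\pm_{\varepsilon,\alpha}(\nabla)}\phi^\pm_{\varepsilon,\alpha}+\sum_\pm\int_0^te^{(t-t')\lambda^\pm_{\varepsilon,\alpha}(\nabla)}f^\pm_{\varepsilon,\alpha}(t')\,dt',$$ where $\lambda^\pm_{\varepsilon,\alpha}(\nabla)=\varepsilon^{-2}\big(-\alpha\pm\sqrt{\alpha^2-\varepsilon^2\langle\nabla\rangle^2}\big)$, $\phi^\pm_{\varepsilon,\alpha}=\dfrac{\mp\varepsilon^2\lambda^\mp_{\varepsilon,\alpha}(\nabla)\phi_0\pm\varepsilon\phi_1}{2\sqrt{\alpha^2-\varepsilon^2\langle\nabla\rangle^2}}$,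 $f^\pm_{\varepsilon,\alpha}(t)=\dfrac{\pm f(t)}{2\sqrt{\alpha^2-\varepsilon^2\langle\nabla\rangle^2}}$. *)

(* Defs.v *)
From HB Require Import structures.
From mathcomp Require Import all_boot all_order all_algebra.
From mathcomp Require Import complex ring lra.
From mathcomp Require Import all_classical all_reals all_analysis.

Set Implicit Arguments.
Unset Strict Implicit.
Unset Printing Implicit Defensive.

Import Order.TTheory GRing.Theory Num.Theory.
Import numFieldNormedType.Exports.

Local Open Scope classical_set_scope.
Local Open Scope complex_scope.
Local Open Scope ring_scope.

(* R-valued, unlike the R[i]-valued 'Re and 'Im of numClosedFieldType. *)
Local Notation Re := (@complex.Re _).
Local Notation Im := (@complex.Im _).

Section ComplexAnalysis.
Variable R : realType.

Definition cexp (z : R[i]) : R[i] :=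
  (expR (Re z) * cos (Im z)) +i* (expR (Re z) * sin (Im z)).

(* [sqrtc] is the principal square root: for r >= 0 and theta in ]-pi, pi], the
   root of r e^(i theta) is (sqrt r) e^(i theta / 2). *)
Lemma sqrtc_polar (r theta : R) : 0 <= r -> - pi < theta <= pi ->
  sqrtc (r%:C * cexp (0 +i* theta)) =
  (Num.sqrt r)%:C * cexp (0 +i* (theta / 2)).
Proof.
move=> r0 /andP[t1 t2]; rewrite /cexp /= expR0 !mul1r.
have th : theta = (theta / 2) *+ 2 by rewrite -mulr_natr; field.
set h := theta / 2 in th *.
have h1 : - (pi / 2) < h by rewrite /h; lra.
have h2 : h <= pi / 2 by rewrite /h; lra.
have c0 : 0 <= cos h by apply: cos_ge0_pihalf; lra.
have cs : cos h ^+ 2 + sin h ^+ 2 = 1 by exact: cos2Dsin2.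
have cD : cos theta = cos h ^+ 2 - sin h ^+ 2.
  by rewrite th cos_mulr2n -mulr_natr; lra.
have sD : sin theta = 2 * (cos h * sin h) by rewrite th sin_mulr2n -mulr_natr mulrC.
rewrite !mul0r subr0 !addr0.
have -> : (r * cos theta) ^+ 2 + (r * sin theta) ^+ 2 = r ^+ 2.
  by rewrite !exprMn -mulrDr cos2Dsin2 mulr1.
rewrite sqrtr_sqr (ger0_norm r0).
have -> : (r + r * cos theta) / 2 = r * cos h ^+ 2.
  by rewrite cD (_ : sin h ^+ 2 = 1 - cos h ^+ 2); [field | lra].
have -> : (r - r * cos theta) / 2 = r * sin h ^+ 2.
  by rewrite cD (_ : cos h ^+ 2 = 1 - sin h ^+ 2); [field | lra].
rewrite !(sqrtrM (_ ^+ 2) r0) !sqrtr_sqr (ger0_norm c0).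
apply/eqP; rewrite eq_complex /= !mul0r subr0 addr0 eqxx /=; apply/eqP.
have [->|rn0] := eqVneq r 0; first by rewrite sqrtr0 !mul0r mulr0.
have rp : 0 < r by rewrite lt_neqAle eq_sym rn0.
rewrite mulrCA; congr (_ * _).
have [hlt|hge] := ltP h (pi / 2); last first.
  have hE : h = pi / 2 by apply/le_anti; rewrite h2 hge.
  by rewrite sD hE cos_pihalf sin_pihalf mul0r !mulr0 eqxx normr1 mulr1.
have cp : 0 < cos h by apply: cos_gt0_pihalf; rewrite h1 hlt.
rewrite sD !mulf_eq0 pnatr_eq0 (negbTE rn0) (gt_eqF cp) /=.
have [->|s0] := eqVneq (sin h) 0; first by rewrite normr0 mulr0.
by rewrite !sgrM (gtr0_sg rp) (gtr0_sg cp) gtr0_sg// !mul1r -numEsg.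
Qed.

Definition cderivable (g : R -> R[i]) (t : R) : Prop :=
  derivable (fun s => Re (g s)) t 1 /\ derivable (fun s => Im (g s)) t 1.

Definition cderive (g : R -> R[i]) (t : R) : R[i] :=
  ('D_1 (fun s => Re (g s)) t) +i* ('D_1 (fun s => Im (g s)) t).

Definition cmeasurable (D : set R) (g : R -> R[i]) : Prop :=
  measurable_fun D (fun s => Re (g s)) /\ measurable_fun D (fun s => Im (g s)).

Definition cintegral (D : set R) (g : R -> R[i]) : R[i] :=
  (\int[lebesgue_measure]_(s in D) Re (g s))%R +i*
  (\int[lebesgue_measure]_(s in D) Im (g s))%R.

End ComplexAnalysis.

Section Torus.
Variables (R : realType) (d : nat).

(* Functions on the torus (R / 2 pi Z)^d are 2 pi Z^d-periodic functions on R^d. *)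
Definition periodic (psi : 'rV[R]_d -> R[i]) : Prop :=
  forall (x : 'rV[R]_d) (n : 'rV[int]_d),
    psi (x + \row_j (2 * pi * (n 0 j)%:~R)) = psi x.

(* Iterated partial derivative along the list [l] of coordinate directions. *)
Definition partials (l : seq 'I_d) (g : 'rV[R]_d -> R) : 'rV[R]_d -> R :=
  foldr (fun i h x => 'D_(delta_mx 0 i) h x) g l.

Definition smooth (g : 'rV[R]_d -> R) : Prop :=
  forall l : seq 'I_d, continuous (partials l g) /\
    forall (i : 'I_d) (x : 'rV[R]_d), derivable (partials l g) x (delta_mx 0 i).

Definition test_function (psi : 'rV[R]_d -> R[i]) : Prop :=
  [/\ periodic psi, smooth (fun x => Re (psi x)) & smooth (fun x => Im (psi x))].

(* A generalized function is given by its complex-bilinear pairing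
   psi |-> <u, psi> (for an integrable u this is the integral of u psi). *)
Definition torus_pairing := ('rV[R]_d -> R[i]) -> R[i].

(* Continuity on C^oo(T^d): the pairing is bounded by some C^N norm. *)
Definition torus_distribution (u : torus_pairing) : Prop :=
  (forall (a : R[i]) (psi chi : 'rV[R]_d -> R[i]),
     test_function psi -> test_function chi ->
     u (fun x => a * psi x + chi x) = a * u psi + u chi) /\
  (exists (N : nat) (B : R), forall psi (M : R), test_function psi ->
     (forall (l : seq 'I_d) (x : 'rV[R]_d), (size l <= N)%N ->
        `|partials l (fun y => Re (psi y)) x| <= M /\
        `|partials l (fun y => Im (psi y)) x| <= M) ->
     Normc.normc (u psi) <= B * M).

Definition fourier_mode (k : 'rV[int]_d) (x : 'rV[R]_d) : R[i] :=
  ((2 * pi) `^ (- (d%:R / 2)))%:C * cexp (0 +i* \sum_j (k 0 j)%:~R * x 0 j).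

Definition fourier (u : torus_pairing) (k : 'rV[int]_d) : R[i] :=
  u (fun x => (fourier_mode k x)^*).

Definition bracket (k : 'rV[int]_d) : R :=
  Num.sqrt (1 + \sum_j (k 0 j)%:~R ^+ 2).

Definition sobolev_norm (s : R) (u : torus_pairing) : \bar R :=
  sqrte (\esum_(k in [set: 'rV[int]_d])
           (bracket k `^ (2 * s) * Normc.normc (fourier u k) ^+ 2)%:E).

Definition sobolev (s : R) (u : torus_pairing) : Prop :=
  torus_distribution u /\ (sobolev_norm s u < +oo)%E.

(* The Hilbert norm of H^s x H^(s-1). *)
Definition energy_norm (s : R) (u v : torus_pairing) : \bar R :=
  sqrte (sobolev_norm s u ^+ 2 + sobolev_norm (s - 1) v ^+ 2)%E.

End Torus.

Section Evolution.
Variables (R : realType) (d : nat).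
Local Notation torus_pairing := (torus_pairing R d).

(* The L^p(0, T) norm of a [0, +oo]-valued function of time. *)
Definition time_norm (p : \bar R) (T : R) (g : R -> \bar R) : \bar R :=
  'N[lebesgue_measure]_p[(g \_ `]0, T[)%R].

(* In L^2(0, T; H^s): as H^s is a separable Hilbert space, strong measurability is
   measurability of every Fourier coefficient. *)
Definition L2_sobolev (s T : R) (f : R -> torus_pairing) : Prop :=
  [/\ {ae lebesgue_measure, forall t, t \in `]0, T[ -> sobolev s (f t)},
      forall k, cmeasurable `]0, T[ (fun t => fourier (f t) k) &
      (time_norm 2%:E T (fun t => sobolev_norm s (f t)) < +oo)%E].

(* The time derivative, tested pointwise: <(d/dt u)(t), psi> = d/dt <u(t), psi>. *)
Definition time_derivative (u : R -> torus_pairing) (t : R) : torus_pairing :=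
  fun psi => cderive (fun s => u s psi) t.

Section Mild.
Variables (alpha : R[i]) (eps : R).

(* The signs + and - are encoded by [false] and [true], as (-1) ^+ b. *)

Definition disc (k : 'rV[int]_d) : R[i] :=
  sqrtc (alpha ^+ 2 - (eps ^+ 2 * bracket R k ^+ 2)%:C).

Definition lambda (b : bool) (k : 'rV[int]_d) : R[i] :=
  (eps ^- 2)%:C * (- alpha + (-1) ^+ b * disc k).

(* Fourier coefficients of phi^+- and f^+-; a Fourier multiplier m(nabla) acts on
   Fourier coefficients by multiplication with m(k). *)
Definition phi_pm (b : bool) (phi0 phi1 : torus_pairing) (k : 'rV[int]_d) : R[i] :=
  (- (-1) ^+ b * (eps ^+ 2)%:C * lambda (~~ b) k * fourier phi0 k
   + (-1) ^+ b * eps%:C * fourier phi1 k) / (2 * disc k).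

Definition f_pm (b : bool) (f : R -> torus_pairing) (t : R) (k : 'rV[int]_d) : R[i] :=
  (-1) ^+ b * fourier (f t) k / (2 * disc k).

Definition mild_solution (T : R) (phi0 phi1 : torus_pairing) (f u : R -> torus_pairing) :
    Prop :=
  forall t, t \in `[0, T] -> torus_distribution (u t) /\
    forall k, fourier (u t) k =
      \sum_(b : bool) cexp (t%:C * lambda b k) * phi_pm b phi0 phi1 k +
      \sum_(b : bool) cintegral `[0, t]
        (fun t' => cexp ((t - t')%:C * lambda b k) * f_pm b f t' k).

End Mild.
End Evolution.

Section LocalBounds.
Variable R : realType.

(* C_+ minus the half-line of positive reals *)
Definition admissible (alpha : R[i]) : Prop := 0 < Re alpha /\ Im alpha != 0.

Definition locally_bounded_on (D : R[i] -> Prop) (C : R[i] -> R) : Prop :=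
  forall a, D a -> exists delta M : R, 0 < delta /\
    forall b, D b -> Normc.normc (b - a) < delta -> `|C b| <= M.

End LocalBounds.

(* Main.v *)
Require Import Defs.
From mathcomp Require Import all_boot all_order all_algebra.
From mathcomp Require Import complex ring lra.
From mathcomp Require Import all_classical all_reals all_analysis.
From mathcomp Require Import measurable_realfun ess_sup_inf.
Import Order.TTheory GRing.Theory Num.Theory.
Import numFieldNormedType.Exports.
Local Open Scope classical_set_scope.
Local Open Scope complex_scope.
Local Open Scope ring_scope.

(** With beta = <k>, the Fourier coefficient y of the solution at k obeys
    eps^2 y'' + 2 alpha y' + beta^2 y = g. Multiplying by the conjugate of y'
    and taking real parts gives, formally, for E = |beta y|^2 + |eps y'|^2,
      E' = 2 Re (g conj(y')) - 4 Re(alpha) |y'|^2 <= |g|^2 / (4 Re(alpha)).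
    So E(t) is bounded by E(0) plus a multiple of the squared L^2 norm of g, and
    the constant sees only Re(alpha): not eps, not the time, not k. This is why
    C = 2 + 1 / Re(alpha) is possible. The condition Im(alpha) != 0 keeps the
    discriminant away from zero (disc_neq0), so that the mild form is an honest
    solution formula.

    Since g is only square integrable, y' need not be differentiable and the
    computation above is not available as it stands. It is therefore done on
    the adjoint system, whose solutions are combinations of exponentials. For
    constants a and c, the number a beta y(t) + c eps y'(t) is a pairing of the
    data with the adjoint solution that starts from (a, c) (osc_duality). The
    energy of that solution decreases, and the amount lost controls the square
    integral of its second component (dual_dissipation). Taking for a and c the
    conjugates of beta y(t) and eps y'(t) turns the pairing into E(t), and
    Young's inequality absorbs the adjoint terms (osc_energy_le).

    The two convolutions of g with exponentials in the mild form are not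
    differentiable one by one, but their difference is the convolution of g with
    an impulse response K such that K(0) = 0, and such a convolution is
    differentiable at every time (is_derive_convolution). Hence the velocity
    exists pointwise and is itself a convolution.

    It remains to sum over k. The weights match because
    beta^(2 (sigma - 1)) beta^2 = beta^(2 sigma), and the sum of the time
    integrals of g is at most the integral of the sum, by monotonicity over
    finite sets of frequencies (esum_integral_le). *)

Set Implicit Arguments.
Unset Strict Implicit.
Unset Printing Implicit Defensive.

Local Notation Re := (@complex.Re _).
Local Notation Im := (@complex.Im _).

(** * Complex-valued functions of a real variable *)

Section ComplexCurves.
Variable R : realType.
Implicit Types (f g : R -> R[i]) (c w z : R[i]) (t : R).

(** The relational form of the pair cderivable, cderive, in the style of
    is_derive. *)
Definition is_cderive g t w : Prop :=
  is_derive t 1 (fun s => Re (g s)) (Re w) /\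
  is_derive t 1 (fun s => Im (g s)) (Im w).

Lemma complex_ext (x y : R[i]) : Re x = Re y -> Im x = Im y -> x = y.
Proof. by case: x y => [a b] [a' b'] /= -> ->. Qed.

Lemma cReM w z : Re (w * z) = Re w * Re z - Im w * Im z.
Proof. by case: w z => [? ?] [? ?]. Qed.

Lemma cImM w z : Im (w * z) = Re w * Im z + Im w * Re z.
Proof. by case: w z => [? ?] [? ?]. Qed.

Lemma cReD w z : Re (w + z) = Re w + Re z.
Proof. by case: w z => [? ?] [? ?]. Qed.

Lemma cImD w z : Im (w + z) = Im w + Im z.
Proof. by case: w z => [? ?] [? ?]. Qed.

Lemma cderiveE (g : R -> R[i]) (t : R) (w : R[i]) :
  is_cderive g t w -> cderivable g t /\ cderive g t = w.
Proof.
move=> [[d1 e1] [d2 e2]]; split; first by split; [exact: d1 | exact: d2].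
by rewrite /cderive e1 e2; case: w {d1 d2 e1 e2}.
Qed.

Lemma near_eq_is_cderive (f g : R -> R[i]) (t : R) w :
  (\forall s \near t, f s = g s) -> is_cderive f t w -> is_cderive g t w.
Proof.
move=> fg [f1 f2]; split.
  by apply: near_eq_is_derive f1; apply: filterS fg => s ->.
by apply: near_eq_is_derive f2; apply: filterS fg => s ->.
Qed.

Lemma is_cderiveD f g t w z : is_cderive f t w -> is_cderive g t z ->
  is_cderive (fun s => f s + g s) t (w + z).
Proof.
move=> [f1 f2] [g1 g2]; split.
  rewrite cReD; under eq_fun do rewrite cReD; exact: is_deriveD.
rewrite cImD; under eq_fun do rewrite cImD; exact: is_deriveD.
Qed.

Lemma is_cderiveMl c g t z : is_cderive g t z ->
  is_cderive (fun s => c * g s) t (c * z).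
Proof.
move=> [g1 g2]; split.
  rewrite cReM; under eq_fun do rewrite cReM; exact: is_deriveB.
rewrite cImM; under eq_fun do rewrite cImM; exact: is_deriveD.
Qed.

Lemma is_cderiveB f g t w z : is_cderive f t w -> is_cderive g t z ->
  is_cderive (fun s => f s - g s) t (w - z).
Proof.
move=> df dg; rewrite -[- z]mulN1r.
have -> : (fun s => f s - g s) = (fun s => f s + -1 * g s).
  by apply/funext => s; rewrite mulN1r.
exact/is_cderiveD/is_cderiveMl.
Qed.

Lemma is_cderive_cexp c t :
  is_cderive (fun s => cexp (s%:C * c)) t (c * cexp (t%:C * c)).
Proof.
have lin r : is_derive t 1 (fun s : R => s * r) r.
  apply: is_derive_eq.
  by rewrite scaler0 add0r /GRing.scale /= mulr1.
have dex : is_derive t 1 (fun s => expR (s * Re c)) (Re c * expR (t * Re c)).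
  by rewrite mulrC; exact: (@is_derive1_comp _ expR (fun s => s * Re c)).
have dco : is_derive t 1 (fun s => cos (s * Im c)) (- Im c * sin (t * Im c)).
  rewrite mulNr -mulrN mulrC.
  exact: (@is_derive1_comp _ cos (fun s => s * Im c)).
have dsi : is_derive t 1 (fun s => sin (s * Im c)) (Im c * cos (t * Im c)).
  by rewrite mulrC; exact: (@is_derive1_comp _ sin (fun s => s * Im c)).
have re s : Re (s%:C * c) = s * Re c by rewrite cReM /= mul0r subr0.
have im s : Im (s%:C * c) = s * Im c by rewrite cImM /= mul0r addr0.
split; rewrite /cexp /=.
  under eq_fun do rewrite re im.
  apply: is_derive_eq; rewrite cReM /= re im /GRing.scale /=; ring.
under eq_fun do rewrite re im.
apply: is_derive_eq; rewrite cImM /= re im /GRing.scale /=; ring.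
Qed.

Lemma cexp0 : cexp 0 = 1 :> R[i].
Proof. by rewrite /cexp /= expR0 cos0 sin0 mulr0 mulr1. Qed.

(** The squared modulus, as a polynomial so that it can be differentiated. *)
Definition sqn z : R := Re z ^+ 2 + Im z ^+ 2.

Lemma sqn_ge0 (z : R[i]) : 0 <= sqn z.
Proof. by rewrite addr_ge0 ?sqr_ge0. Qed.

Lemma sqnM (z w : R[i]) : sqn (z * w) = sqn z * sqn w.
Proof. by case: z w => [a b] [a' b']; rewrite /sqn /=; ring. Qed.

Lemma sqn_real (r : R) : sqn r%:C = r ^+ 2.
Proof. by rewrite /sqn /= expr0n addr0. Qed.

Lemma sqr_normc (z : R[i]) : Normc.normc z ^+ 2 = sqn z.
Proof. by case: z => a b; rewrite /= sqr_sqrtr// addr_ge0 ?sqr_ge0. Qed.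

Lemma sqnJ z : sqn z^* = sqn z.
Proof. by case: z => z1 z2; rewrite /sqn /= sqrrN. Qed.

Lemma ReJM z : Re (z^* * z) = sqn z.
Proof. by case: z => z1 z2; rewrite /sqn /=; ring. Qed.

Lemma is_derive_sqn (g : R -> R[i]) (t : R) w : is_cderive g t w ->
  is_derive t 1 (fun s => sqn (g s)) (2 * (Re (g t) * Re w + Im (g t) * Im w)).
Proof.
by move=> [g1 g2]; rewrite /sqn; apply: is_derive_eq; rewrite /GRing.scale /=; ring.
Qed.

End ComplexCurves.

(** * Convolution of a kernel with an integrable function *)

Section RealIntegrable.
Context d (T : measurableType d) (R : realType).
Variables (mu : {measure set T -> \bar R}) (D : set T).
Hypothesis mD : measurable D.
Implicit Types f g : T -> R.

Lemma integrableD_EFin f g : mu.-integrable D (EFin \o f) ->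
  mu.-integrable D (EFin \o g) -> mu.-integrable D (EFin \o (fun x => f x + g x)).
Proof. by move=> fi gi; have := integrableD mD fi gi. Qed.

Lemma integrableB_EFin f g : mu.-integrable D (EFin \o f) ->
  mu.-integrable D (EFin \o g) -> mu.-integrable D (EFin \o (fun x => f x - g x)).
Proof. by move=> fi gi; have := integrableB mD fi gi. Qed.

Lemma integrableZl_EFin c f : mu.-integrable D (EFin \o f) ->
  mu.-integrable D (EFin \o (fun x => c * f x)).
Proof. by move=> fi; have := integrableZl mD c fi. Qed.

End RealIntegrable.

Section Convolution.
Variables (R : realType) (T t : R) (k k' g : R -> R).
Notation mu := (@lebesgue_measure R).
Hypothesis tT : t \in `]0, T[.
Hypothesis k0 : k 0 = 0.
Hypothesis dk : forall x : R, is_derive x 1 k (k' x).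
Hypothesis ck' : continuous k'.
Hypothesis ig : mu.-integrable `]0, T[ (EFin \o g).

(* The causal extension of k: as k 0 = 0 it is Lipschitz across the origin, and
   it puts all the convolutions on the same interval `]0, T[. *)
Let kp (x : R) := k (Num.max x 0).

Let t0 : 0 < t. Proof. by move: tT; rewrite in_itv /= => /andP[]. Qed.
Let tltT : t < T. Proof. by move: tT; rewrite in_itv /= => /andP[]. Qed.
Let T0 : 0 < T. Proof. exact: lt_trans tltT. Qed.

Let ck : continuous k.
Proof.
by move=> x; apply: differentiable_continuous; apply/derivable1_diffP;
  exact: ex_derive.
Qed.

Let kp_lip : exists2 M : R, 0 <= M & forall x y, x <= T -> y <= T ->
  `|kp x - kp y| <= M * `|x - y|.
Proof.
have [c _ cM] : exists2 c, c \in `[0, T] &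
    forall x, x \in `[0, T] -> `|k' x| <= `|k' c|.
  apply: (@EVT_max _ (fun x => `|k' x|)); first exact: ltW.
  apply: continuous_subspaceT => x.
  by apply: continuous_comp; [exact: ck' | exact: norm_continuous].
exists `|k' c| => //.
suff H x y : 0 <= x -> x <= y -> y <= T -> `|k y - k x| <= `|k' c| * (y - x).
  have H' x y : x <= y -> y <= T -> `|kp y - kp x| <= `|k' c| * `|y - x|.
    move=> xy yT; rewrite /kp; apply: le_trans (H _ _ _ _ _) _.
    - by rewrite le_max lexx orbT.
    - by rewrite ge_max !le_max xy lexx !orbT.
    - by rewrite ge_max yT ltW.
    apply: ler_wpM2l => //; rewrite ger0_norm ?subr_ge0//.
    by case: (leP y 0) => hy; case: (leP x 0) => hx; lra.
  move=> x y xT yT; have [xy|/ltW xy] := leP x y.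
    by rewrite distrC (distrC x); exact: H'.
  exact: H'.
move=> x0 xy yT.
have [z zxy ->] := @MVT_segment _ k k' x y xy (fun z _ => dk z)
  (continuous_subspaceT ck).
rewrite normrM (ger0_norm (_ : 0 <= y - x)) ?subr_ge0//.
apply: ler_wpM2r; rewrite ?subr_ge0//; apply: cM.
by move: zxy; rewrite !in_itv /= => /andP[] *; apply/andP; split; lra.
Qed.

Let kp_cont : continuous kp.
Proof.
move=> x; apply: continuous_comp; last exact: ck.
by apply: continuous_max => ?; [exact: cvg_id | exact: cvg_cst].
Qed.

Let kpx_cont x : continuous (fun s => kp (x - s)).
Proof.
move=> s; apply: (@continuous_comp _ _ _ (fun s => x - s) kp); last exact: kp_cont.
by apply: cvgB; [exact: cvg_cst | exact: cvg_id].
Qed.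

Let ikp x : x <= T -> mu.-integrable `]0, T[ (fun s => (kp (x - s) * g s)%:E).
Proof.
move=> xT; have [M M0 lip] := kp_lip.
apply: (@integrableMr _ _ _ mu _ _ (fun s => kp (x - s)) (EFin \o g)) => //.
  by apply: measurable_funTS; apply: continuous_measurable_fun.
exists (M * (`|x| + T)); split; first exact: num_real.
move=> r rM s /=; rewrite in_itv /= => /andP[s0 sT].
apply: le_trans (ltW rM).
have -> : kp (x - s) = kp (x - s) - kp 0 by rewrite {3}/kp maxxx k0 subr0.
apply: le_trans (lip _ _ _ _) _; [by lra | by lra |].
rewrite subr0; apply: ler_wpM2l => //; apply: le_trans (ler_normB _ _) _.
by rewrite lerD2l ger0_norm; lra.
Qed.

Let convE x : x \in `]0, T[ ->
  \int[mu]_(s in `]0, x[) (k (x - s) * g s) =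
  \int[mu]_(s in `]0, T[) (kp (x - s) * g s).
Proof.
rewrite in_itv /= => /andP[x0 xT].
have -> : `]0, x[%classic = `]0, T[ `&` `]0, x[ :> set R.
  apply/seteqP; split => s /=; rewrite !in_itv /=; last by case.
  by move=> /andP[s0 sx]; rewrite s0 sx (lt_trans sx xT).
rewrite Rintegral_mkcondr; apply: eq_Rintegral => s /[!inE] /=.
rewrite in_itv /= => /andP[s0 sT].
rewrite patchE mem_setE in_itv /= s0 /= /kp.
case: ifPn => [sx|]; first by rewrite max_l//; lra.
by rewrite -leNgt => xs; rewrite max_r ?k0 ?mul0r//; lra.
Qed.

(* Difference quotients converge off the null set s = t, where kp has a corner,
   and the Lipschitz bound dominates them by a multiple of |g|. *)
Let lim_conv (h : R^nat) : (forall n, h n != 0) -> h @ \oo --> 0 ->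
  (forall n, h n + t \in `]0, T[) ->
  (fun n => (h n)^-1 * (\int[mu]_(s in `]0, h n + t[) (k (h n + t - s) * g s) -
                  \int[mu]_(s in `]0, t[) (k (t - s) * g s))) @ \oo -->
  \int[mu]_(s in `]0, t[) (k' (t - s) * g s).
Proof.
move=> hn0 h0 hT.
have hT' n : h n + t <= T by have := hT n; rewrite in_itv /= => /andP[_ /ltW].
have [M M0 lip] := kp_lip.
pose L s := (if s < t then k' (t - s) else 0) * g s.
pose F n s := (h n)^-1 * (kp (h n + t - s) * g s - kp (t - s) * g s).
have -> : \int[mu]_(s in `]0, t[) (k' (t - s) * g s) =
    \int[mu]_(s in `]0, T[) L s.
  have -> : `]0, t[%classic = `]0, T[ `&` `]0, t[ :> set R.
    apply/seteqP; split => s /=; rewrite !in_itv /=; last by case.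
    by move=> /andP[s0 sx]; rewrite s0 sx (lt_trans sx tltT).
  rewrite Rintegral_mkcondr; apply: eq_Rintegral => s /[!inE] /=.
  rewrite in_itv /= => /andP[s0 sT].
  by rewrite patchE mem_setE in_itv /= s0 /= /L; case: ifP; rewrite ?mul0r.
have iB n : mu.-integrable `]0, T[
    (EFin \o (fun s => kp (h n + t - s) * g s - kp (t - s) * g s)).
  by apply: integrableB_EFin; [by [] | exact: ikp | apply: ikp; exact: ltW].
have iF n : mu.-integrable `]0, T[ (EFin \o F n) by exact: integrableZl_EFin.
have FE : (fun n => (h n)^-1 *
     (\int[mu]_(s in `]0, h n + t[) (k (h n + t - s) * g s) -
                  \int[mu]_(s in `]0, t[) (k (t - s) * g s))) =
    (fun n => \int[mu]_(s in `]0, T[) F n s).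
  apply/funext => n; rewrite !convE//.
  rewrite -RintegralB//; [|exact: ikp|by apply: ikp; exact: ltW].
  by rewrite -RintegralZl.
rewrite FE.
have mg : measurable_fun `]0, T[ g by apply/measurable_EFinP; exact: measurable_int ig.
have mL : measurable_fun `]0, T[ (EFin \o L).
  apply/measurable_EFinP; apply: measurable_funM => //.
  apply: measurable_funTS; apply: measurable_fun_ifT => //.
    exact: measurable_fun_ltr.
  apply: continuous_measurable_fun => s.
  apply: (@continuous_comp _ _ _ (fun s => t - s) k'); last exact: ck'.
  by apply: cvgB; [exact: cvg_cst | exact: cvg_id].
have aeF : {ae mu, forall s, `]0, T[%classic s ->
    (fun n => (EFin \o F n) s) @ \oo --> (EFin \o L) s}.
  exists [set t]; split => //; first exact: lebesgue_measure_set1.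
  move=> s /=; apply: contra_notP => st sT.
  apply: cvg_EFin; first exact: nearW.
  rewrite /comp /F /L.
  have dkp : is_derive t 1 (fun x => kp (x - s)) (if s < t then k' (t - s) else 0).
    case: ltgtP st => // [st|st] _.
      apply: (@near_eq_is_derive _ _ _ (fun x => k (x - s))) => //.
        near=> x; rewrite /kp max_l//.
        have : s < x by near: x; exact: lt_nbhsr.
        by move=> ?; lra.
      have dsub : is_derive t 1 (fun x : R => x - s) 1.
        by apply: is_derive_eq; rewrite subr0.
      rewrite -[k' _]mulr1.
      exact: (@is_derive1_comp _ k (fun x => x - s)).
    apply: (@near_eq_is_derive _ _ _ (cst 0)) => //.
    near=> x; rewrite /kp max_r ?k0//.
    have : x < s by near: x; exact: lt_nbhsl.
    by move=> ?; lra.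
  have [/cvg_ex[/= l fl] El] := dkp.
  have <- : l = if s < t then k' (t - s) else 0.
    by rewrite -El; apply/esym/cvg_lim.
  under eq_fun do rewrite -mulrBl mulrA.
  apply: cvgM; last exact: cvg_cst.
  move: fl => /cvgr_dnbhsP/(_ h (conj hn0 h0)).
  by under [in X in X -> _]eq_fun do rewrite /GRing.scale /= mulr1.
have domF : {ae mu, forall s n, `]0, T[%classic s ->
    (`|(EFin \o F n) s| <= (M * `|g s|)%:E)%E}.
  apply: aeW => /=; move=> s n; rewrite in_itv /= => /andP[s0 sT].
  rewrite lee_fin /F -mulrBl mulrA normrM; apply: ler_wpM2r => //.
  rewrite normrM normfV ler_pdivrMl ?normr_gt0//.
  have -> : `|h n| * M = M * `|h n + t - s - (t - s)|.
    by rewrite mulrC; congr (_ * `|_|); ring.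
  by have := hT' n; have := tltT; move=> ? ?; apply: lip; lra.
have iM : mu.-integrable `]0, T[ (EFin \o (fun s => M * `|g s|)).
  by apply: integrableZl_EFin => //; exact: integrable_abse ig.
have [iL _ cv] := @dominated_convergence _ _ _ mu _ (measurable_itv _) _ _ _
  (fun n => measurable_int _ (iF n)) mL aeF iM domF.
apply: fine_cvg; rewrite fineK; first exact: cv.
exact: integrable_fin_num.
Unshelve. all: by end_near. Qed.

(** Leibniz rule without a boundary term: that term would be k 0 * g t, and g has
    no value at a single time. With k 0 = 0 the convolution is differentiable
    at every t, even where g is badly behaved. *)
Lemma is_derive_convolution :
  is_derive t 1 (fun x => \int[mu]_(s in `]0, x[) (k (x - s) * g s))
   (\int[mu]_(s in `]0, t[) (k' (t - s) * g s)).
Proof.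
set Y := fun x => _; set l := \int[mu]_(_ in _) _.
suff cv : h^-1 *: (Y (h *: 1 + t) - Y t) @[h --> 0^'] --> l.
  by apply: DeriveDef; [apply/cvg_ex; exists l | exact/cvg_lim].
apply/cvgr_dnbhsP => u [u0 ucvg].
pose rho := Num.min t (T - t) / 2.
have rho0 : 0 < rho by rewrite divr_gt0// lt_min t0 subr_gt0.
have [rhot rhoT] : rho < t /\ rho < T - t.
  have := t0; have := tltT; rewrite /rho => ? ?.
  by case: (leP t (T - t)) => ?; split; lra.
(* Truncating the increments keeps t + h n inside `]0, T[ for all n. *)
pose h n := if `|u n| < rho then u n else rho.
have uh : {near \oo, h =1 u}.
  near=> n; rewrite /h ifT//; near: n.
  by move/cvgr0_norm_lt : ucvg => /(_ _ rho0).
have hcvg : h @ \oo --> 0.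
  by apply: cvg_trans ucvg; apply: near_eq_cvg; near do apply/esym.
have hn0 n : h n != 0 by rewrite /h; case: ifP => // _; rewrite gt_eqF.
have hT n : h n + t \in `]0, T[.
  have : `|h n| <= rho by rewrite /h; case: ifPn => [/ltW//|_]; rewrite gtr0_norm.
  by rewrite ler_norml in_itv /= => /andP[? ?]; apply/andP; split; lra.
have := lim_conv hn0 hcvg hT.
apply: cvg_trans; apply: near_eq_cvg; near=> n.
have -> : u n = h n by apply/esym; near: n.
by rewrite /Y /GRing.scale /= mulr1.
Unshelve. all: by end_near. Qed.

End Convolution.

Section ComplexIntegral.
Variable R : realType.
Notation mu := (@lebesgue_measure R).
Implicit Types (f g : R -> R[i]).

(** The domain is a set of measurableTypeR R, the measurable structure of the
    Lebesgue measure, so that its measurability hypotheses fit the integrals. *)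
Definition cintegrable (D : set (measurableTypeR R)) g : Prop :=
  mu.-integrable D (EFin \o (fun s => Re (g s))) /\
  mu.-integrable D (EFin \o (fun s => Im (g s))).

Lemma cintegrableS (D E : set (measurableTypeR R)) g :
  measurable D -> measurable E -> E `<=` D ->
  cintegrable D g -> cintegrable E g.
Proof.
move=> mD mE ED [g1 g2]; split.
  exact: (integrableS mD mE ED g1).
exact: (integrableS mD mE ED g2).
Qed.

Lemma cintegrableMl (D : set (measurableTypeR R)) c g :
  measurable D -> cintegrable D g -> cintegrable D (fun s => c * g s).
Proof.
move=> mD [g1 g2]; split.
  have -> : (fun s => Re (c * g s)) =
      (fun s => Re c * Re (g s) - Im c * Im (g s)).
    by apply/funext => s; exact: cReM.
  by apply: integrableB_EFin => //; exact: integrableZl_EFin.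
have -> : (fun s => Im (c * g s)) =
    (fun s => Re c * Im (g s) + Im c * Re (g s)).
  by apply/funext => s; exact: cImM.
by apply: integrableD_EFin => //; exact: integrableZl_EFin.
Qed.

Lemma cintegralD (D : set (measurableTypeR R)) f g : measurable D ->
  cintegrable D f -> cintegrable D g ->
  cintegral D (fun s => f s + g s) = cintegral D f + cintegral D g.
Proof.
move=> mD [f1 f2] [g1 g2]; rewrite /cintegral.
apply: complex_ext; rewrite ?cReD ?cImD /=.
  by under eq_Rintegral do rewrite cReD; exact: RintegralD.
by under eq_Rintegral do rewrite cImD; exact: RintegralD.
Qed.

Lemma cintegralMl (D : set (measurableTypeR R)) c g :
  measurable D -> cintegrable D g ->
  cintegral D (fun s => c * g s) = c * cintegral D g.
Proof.
move=> mD [g1 g2]; rewrite /cintegral; apply: complex_ext.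
  rewrite cReM /= -!RintegralZl// -RintegralB//; [|exact: integrableZl_EFin..].
  by apply: eq_Rintegral => s _; rewrite cReM.
rewrite cImM /= -!RintegralZl// -RintegralD//; [|exact: integrableZl_EFin..].
by apply: eq_Rintegral => s _; rewrite cImM.
Qed.

Lemma eq_cintegral (D : set (measurableTypeR R)) g f : {in D, f =1 g} ->
  cintegral D f = cintegral D g.
Proof.
by move=> fg; rewrite /cintegral; congr (_ +i* _); apply: eq_Rintegral => s sD;
  rewrite fg.
Qed.

Lemma cintegral_itv_ccoo (a b : R) g : cintegrable `]a, b[ g ->
  cintegral `[a, b] g = cintegral `]a, b[ g.
Proof.
have cc (h : R -> R) : mu.-integrable `]a, b[ (EFin \o h) ->
    \int[mu]_(s in `[a, b]) h s = \int[mu]_(s in `]a, b[) h s.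
  move=> ih; have mh := measurable_int _ ih.
  rewrite /Rintegral -integral_itv_bndo_bndc; last first.
    exact/emeasurable_fun_itv_obnd_cbndP.
  by rewrite integral_itv_obnd_cbnd.
by move=> [g1 g2]; rewrite /cintegral !cc.
Qed.

Lemma integrable_convolution (k g : R -> R) (x : R) : 0 < x -> continuous k ->
  mu.-integrable `]0, x[ (EFin \o g) ->
  mu.-integrable `]0, x[ (EFin \o (fun s => k (x - s) * g s)).
Proof.
move=> x0 ck gi.
have [c _ cM] : exists2 c, c \in `[0, x] &
    forall s, s \in `[0, x] -> `|k s| <= `|k c|.
  apply: (@EVT_max _ (fun s => `|k s|)); first exact: ltW.
  apply: continuous_subspaceT => s.
  by apply: continuous_comp; [exact: ck | exact: norm_continuous].
apply: (@integrableMr _ _ _ mu _ _ (fun s => k (x - s)) (EFin \o g)) => //.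
  apply: measurable_funTS; apply: continuous_measurable_fun => s.
  apply: (@continuous_comp _ _ _ (fun s => x - s) k); last exact: ck.
  by apply: cvgB; [exact: cvg_cst | exact: cvg_id].
exists `|k c|; split; first exact: num_real.
move=> r rM s /=; rewrite in_itv /= => /andP[s0 sx].
apply: le_trans (ltW rM); apply: cM; rewrite in_itv /=; apply/andP; split; lra.
Qed.

Definition ccontinuous (k : R -> R[i]) : Prop :=
  continuous (fun s => Re (k s)) /\ continuous (fun s => Im (k s)).

Lemma is_cderive_continuous k k' : (forall t : R, is_cderive k t (k' t)) ->
  ccontinuous k.
Proof.
move=> dk; split=> t; have [[d1 _] [d2 _]] := dk t.
  exact/differentiable_continuous/derivable1_diffP.
exact/differentiable_continuous/derivable1_diffP.
Qed.

Lemma cintegrable_convolution k g (x : R) : 0 < x -> ccontinuous k ->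
  cintegrable `]0, x[ g -> cintegrable `]0, x[ (fun s => k (x - s) * g s).
Proof.
move=> x0 [k1 k2] [g1 g2].
have rr := integrable_convolution x0 k1 g1.
have ri := integrable_convolution x0 k1 g2.
have ir := integrable_convolution x0 k2 g1.
have ii := integrable_convolution x0 k2 g2.
have mI : measurable (`]0, x[%classic : set (measurableTypeR R)) by [].
split.
  have -> : (fun s => Re (k (x - s) * g s)) =
      (fun s => Re (k (x - s)) * Re (g s) - Im (k (x - s)) * Im (g s)).
    by apply/funext => s; exact: cReM.
  exact: (integrableB_EFin mI rr ii).
have -> : (fun s => Im (k (x - s) * g s)) =
    (fun s => Re (k (x - s)) * Im (g s) + Im (k (x - s)) * Re (g s)).
  by apply/funext => s; exact: cImM.
exact: (integrableD_EFin mI ri ir).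
Qed.

Lemma is_cderive_convolution (T t : R) k k' g : t \in `]0, T[ -> k 0 = 0 ->
  (forall x : R, is_cderive k x (k' x)) -> ccontinuous k' ->
  cintegrable `]0, T[ g ->
  is_cderive (fun x => cintegral `]0, x[ (fun s => k (x - s) * g s)) t
    (cintegral `]0, t[ (fun s => k' (t - s) * g s)).
Proof.
move=> tT k0 dk ck' gi; have ck := is_cderive_continuous dk.
have [g1 g2] := gi; have [k1 k2] := ck; have [k1' k2'] := ck'.
have sub (x : R) : x \in `]0, T[ -> cintegrable `]0, x[ g.
  rewrite in_itv /= => /andP[x0 xT]; apply: cintegrableS gi => //.
  by apply: subset_itvl; rewrite bnd_simp ltW.
have pos (x : R) : x \in `]0, T[ -> 0 < x by rewrite in_itv /= => /andP[].
have nT : \forall x \near t, x \in `]0, T[ by exact: near_in_itvoo.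
have dre (x : R) : is_derive x 1 (fun s : R => Re (k s)) (Re (k' x)).
  by have [] := dk x.
have dim (x : R) : is_derive x 1 (fun s : R => Im (k s)) (Im (k' x)).
  by have [] := dk x.
have re0 : Re (k 0) = 0 by rewrite k0.
have im0 : Im (k 0) = 0 by rewrite k0.
have [i1 i2] := sub _ tT; have tp := pos _ tT.
split; rewrite /cintegral /=.
  have -> : \int[mu]_(s in `]0, t[) Re (k' (t - s) * g s) =
      \int[mu]_(s in `]0, t[) (Re (k' (t - s)) * Re (g s)) -
      \int[mu]_(s in `]0, t[) (Im (k' (t - s)) * Im (g s)).
    rewrite -RintegralB//;
      [|exact: (integrable_convolution tp k1' i1)
      |exact: (integrable_convolution tp k2' i2)].
    by apply: eq_Rintegral => s _; rewrite cReM.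
  apply: (@near_eq_is_derive _ _ _
    (fun x : R => \int[mu]_(s in `]0, x[) (Re (k (x - s)) * Re (g s)) -
      \int[mu]_(s in `]0, x[) (Im (k (x - s)) * Im (g s)))).
    near=> x; have xT : x \in `]0, T[ by near: x.
    have [j1 j2] := sub _ xT; have xp := pos _ xT.
    rewrite -RintegralB//;
      [|exact: (integrable_convolution xp k1 j1)
      |exact: (integrable_convolution xp k2 j2)].
    by apply: eq_Rintegral => s _; rewrite cReM.
  apply: is_deriveB.
    exact: (is_derive_convolution tT re0 dre k1' g1).
  exact: (is_derive_convolution tT im0 dim k2' g2).
have -> : \int[mu]_(s in `]0, t[) Im (k' (t - s) * g s) =
    \int[mu]_(s in `]0, t[) (Re (k' (t - s)) * Im (g s)) +
    \int[mu]_(s in `]0, t[) (Im (k' (t - s)) * Re (g s)).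
  rewrite -RintegralD//;
      [|exact: (integrable_convolution tp k1' i2)
      |exact: (integrable_convolution tp k2' i1)].
  by apply: eq_Rintegral => s _; rewrite cImM.
apply: (@near_eq_is_derive _ _ _
  (fun x : R => \int[mu]_(s in `]0, x[) (Re (k (x - s)) * Im (g s)) +
    \int[mu]_(s in `]0, x[) (Im (k (x - s)) * Re (g s)))).
  near=> x; have xT : x \in `]0, T[ by near: x.
  have [j1 j2] := sub _ xT; have xp := pos _ xT.
  rewrite -RintegralD//;
      [|exact: (integrable_convolution xp k1 j2)
      |exact: (integrable_convolution xp k2 j1)].
  by apply: eq_Rintegral => s _; rewrite cImM.
apply: is_deriveD.
  exact: (is_derive_convolution tT re0 dre k1' g2).
exact: (is_derive_convolution tT im0 dim k2' g1).
Unshelve. all: by end_near. Qed.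

End ComplexIntegral.

(** * The damped oscillator of one Fourier mode *)

Section Oscillator.
Variables (R : realType) (alpha : R[i]) (eps beta : R) (delta : R[i]).
Notation mu := (@lebesgue_measure R).
Hypothesis alpha0 : 0 < Re alpha.
Hypothesis eps0 : 0 < eps.
Hypothesis delta0 : delta != 0.
Hypothesis delta_sqr : delta ^+ 2 = alpha ^+ 2 - (eps ^+ 2 * beta ^+ 2)%:C.

(** Roots of eps^2 x^2 + 2 alpha x + beta^2, with false for the sign +. *)
Definition char_root (b : bool) : R[i] :=
  (eps ^- 2)%:C * (- alpha + (-1) ^+ b * delta).

Let epsn0 : eps != 0. Proof. by rewrite gt_eqF. Qed.

Let epsC0 : eps%:C != 0.
Proof. by rewrite eq_complex /= eqxx andbT. Qed.

Let two0 : (2 : R[i]) != 0.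
Proof. by rewrite pnatr_eq0. Qed.

Lemma char_rootP b : eps%:C ^+ 2 * char_root b ^+ 2 =
  - (2 * alpha * char_root b + (beta ^+ 2)%:C).
Proof.
rewrite /char_root fmorphV rmorphXn.
apply/(mulfI (x := eps%:C ^+ 2)); first by rewrite expf_eq0 /=.
have -> : eps%:C ^+ 2 *
   - (2 * alpha * ((eps%:C ^- 2) * (- alpha + (-1) ^+ b * delta))
      + (beta ^+ 2)%:C) =
   - 2 * alpha * (- alpha + (-1) ^+ b * delta) - (eps ^+ 2 * beta ^+ 2)%:C.
  by field.
have -> : - (eps ^+ 2 * beta ^+ 2)%:C = delta ^+ 2 - alpha ^+ 2.
  by rewrite delta_sqr; ring.
by case: b; rewrite /= ?expr1 ?expr0; field.
Qed.

(** The response to a unit impulse: the solution of the unforced equation with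
    position 0 and velocity eps^-2 at time 0. *)
Definition impulse (t : R) : R[i] :=
  (2 * delta)^-1 * (cexp (t%:C * char_root false) - cexp (t%:C * char_root true)).

Definition impulse' (t : R) : R[i] :=
  (2 * delta)^-1 * (char_root false * cexp (t%:C * char_root false)
                - char_root true * cexp (t%:C * char_root true)).

Lemma impulse0 : impulse 0 = 0.
Proof. by rewrite /impulse !mul0r cexp0 subrr mulr0. Qed.

Lemma impulse'0 : eps%:C ^+ 2 * impulse' 0 = 1.
Proof.
rewrite /impulse' !mul0r cexp0 /char_root fmorphV rmorphXn /= expr0 expr1.
by field; rewrite epsC0 delta0.
Qed.

Lemma is_cderive_impulse t : is_cderive impulse t (impulse' t).
Proof.
by apply: is_cderiveMl; apply: is_cderiveB; exact: is_cderive_cexp.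
Qed.

Lemma is_cderive_impulse' t : is_cderive impulse' t
  (- eps%:C ^- 2 * (2 * alpha * impulse' t + beta%:C ^+ 2 * impulse t)).
Proof.
have -> : - eps%:C ^- 2 * (2 * alpha * impulse' t + beta%:C ^+ 2 * impulse t) =
  (2 * delta)^-1 *
  (char_root false * (char_root false * cexp (t%:C * char_root false))
   - char_root true * (char_root true * cexp (t%:C * char_root true))).
  have h b : char_root b * (char_root b * cexp (t%:C * char_root b)) =
     - eps%:C ^- 2 * (2 * alpha * char_root b + beta%:C ^+ 2) *
     cexp (t%:C * char_root b).
    rewrite mulrA -expr2; congr (_ * _).
    apply/(mulfI (x := eps%:C ^+ 2)); first by rewrite expf_eq0 /=.
    by rewrite char_rootP rmorphXn; field.
  by rewrite !h /impulse /impulse'; field; rewrite epsC0 delta0.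
by apply: is_cderiveMl; apply: is_cderiveB; apply: is_cderiveMl;
  exact: is_cderive_cexp.
Qed.

(** In the variables z = (beta y, eps y') the unforced equation is z' = A z with
      A = [[0, beta / eps], [- beta / eps, - 2 alpha / eps^2]].
    The pair (dual_pos, dual_vel) solves the transposed system with initial
    value (a, c). Apart from its last diagonal entry A is real and skew, so that
    this entry alone changes the energy. *)
Section Dual.
Variables (a c : R[i]).

Definition dual_vel (t : R) : R[i] :=
  (beta%:C * a * eps%:C) * impulse t + (eps%:C ^+ 2 * c) * impulse' t.

Definition dual_pos (t : R) : R[i] :=
  (a * eps%:C ^+ 2) * impulse' t
  + (a * (2 * alpha) - c * eps%:C * beta%:C) * impulse t.

Lemma dual_vel0 : dual_vel 0 = c.
Proof.
by rewrite /dual_vel impulse0 mulr0 add0r mulrAC impulse'0 mul1r.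
Qed.

Lemma dual_pos0 : dual_pos 0 = a.
Proof.
by rewrite /dual_pos impulse0 mulr0 addr0 -mulrA impulse'0 mulr1.
Qed.

Lemma is_cderive_dual_vel t : is_cderive dual_vel t
  (beta%:C / eps%:C * dual_pos t - 2 * alpha / eps%:C ^+ 2 * dual_vel t).
Proof.
have -> : beta%:C / eps%:C * dual_pos t - 2 * alpha / eps%:C ^+ 2 * dual_vel t =
  (beta%:C * a * eps%:C) * impulse' t + (eps%:C ^+ 2 * c) *
  (- eps%:C ^- 2 * (2 * alpha * impulse' t + beta%:C ^+ 2 * impulse t)).
  by rewrite /dual_vel /dual_pos; field.
by apply: is_cderiveD; apply: is_cderiveMl;
  [exact: is_cderive_impulse | exact: is_cderive_impulse'].
Qed.

Lemma is_cderive_dual_pos t : is_cderive dual_pos t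
  (- (beta%:C / eps%:C) * dual_vel t).
Proof.
have -> : - (beta%:C / eps%:C) * dual_vel t =
  (a * eps%:C ^+ 2) *
  (- eps%:C ^- 2 * (2 * alpha * impulse' t + beta%:C ^+ 2 * impulse t))
  + (a * (2 * alpha) - c * eps%:C * beta%:C) * impulse' t.
  by rewrite /dual_vel; field.
by apply: is_cderiveD; apply: is_cderiveMl;
  [exact: is_cderive_impulse' | exact: is_cderive_impulse].
Qed.

Definition dual_energy (t : R) : R := sqn (dual_pos t) + sqn (dual_vel t).

Lemma is_derive_dual_energy (t : R) : is_derive t 1 dual_energy
  (- (4 * Re alpha / eps ^+ 2 * sqn (dual_vel t))).
Proof.
have dv := is_derive_sqn (is_cderive_dual_vel t).
have dp := is_derive_sqn (is_cderive_dual_pos t).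
rewrite /dual_energy; apply: is_derive_eq.
set p := dual_pos t; set q := dual_vel t.
rewrite -fmorphV -!rmorphXn -!fmorphV.
case: p => p1 p2; case: q => q1 q2; case: alpha => a1 a2.
rewrite /sqn /=; field; exact: epsn0.
Qed.

End Dual.

Let impulse_cont : ccontinuous impulse.
Proof. exact: is_cderive_continuous is_cderive_impulse. Qed.

Let impulse'_cont : ccontinuous impulse'.
Proof. exact: is_cderive_continuous is_cderive_impulse'. Qed.

(** The energy lost by time t is the integral of the dissipation rate; the time
    is reversed because a forcing at time s acts during t - s. *)
Lemma dual_dissipation (a c : R[i]) (t : R) : 0 < t ->
  mu.-integrable `]0, t[ (EFin \o (fun s => sqn (dual_vel a c (t - s)))) /\
  4 * Re alpha / eps ^+ 2 * \int[mu]_(s in `]0, t[) sqn (dual_vel a c (t - s)) =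
  sqn a + sqn c - dual_energy a c t.
Proof.
move=> t0.
have dsub (s : R) : is_derive s 1 (fun s : R => t - s) (-1).
  by apply: is_derive_eq; ring.
have dN (s : R) : is_derive s 1 (fun s => dual_energy a c (t - s))
    (4 * Re alpha / eps ^+ 2 * sqn (dual_vel a c (t - s))).
  rewrite -[_ * sqn _]opprK -mulrN1.
  apply: (@is_derive1_comp _ (dual_energy a c) (fun s => t - s)).
  exact: is_derive_dual_energy.
have cP : continuous (fun s => sqn (dual_vel a c (t - s))).
  move=> s; apply: differentiable_continuous; apply/derivable1_diffP.
  have dP := is_derive_sqn (is_cderive_dual_vel a c (t - s)).
  have [] // := @is_derive1_comp _ (fun s => sqn (dual_vel a c s))
    (fun s => t - s) _ _ _ dP (dsub s).
have iP : mu.-integrable `[0, t] (EFin \o (fun s => sqn (dual_vel a c (t - s)))).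
  apply: continuous_compact_integrable; first exact: segment_compact.
  exact: continuous_subspaceT.
have iPo : mu.-integrable `]0, t[ (EFin \o (fun s => sqn (dual_vel a c (t - s)))).
  by apply: integrableS iP => //; exact: subset_itv_oo_cc.
split => //.
rewrite -RintegralZl//.
have FTC := @continuous_FTC2 _
  (fun s => 4 * Re alpha / eps ^+ 2 * sqn (dual_vel a c (t - s)))
  (fun s => dual_energy a c (t - s)) 0 t t0.
have N0 : dual_energy a c 0 = sqn a + sqn c.
  by rewrite /dual_energy dual_pos0// dual_vel0.
rewrite -N0 -[in RHS](subr0 t) -[X in dual_energy a c X - _](subrr t).
rewrite /Rintegral.
have mP : measurable_fun `]0, t[
    (fun s => (4 * Re alpha / eps ^+ 2 * sqn (dual_vel a c (t - s)))%:E).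
  by apply: (measurable_int mu); exact: integrableZl_EFin.
rewrite integral_itv_obnd_cbnd// integral_itv_bndo_bndc; last first.
  exact/emeasurable_fun_itv_obnd_cbndP.
rewrite FTC//.
- apply: continuous_subspaceT => s.
  by apply: cvgM; [exact: cvg_cst | exact: cP].
- have cN : continuous (fun s => dual_energy a c (t - s)).
    move=> s; apply: differentiable_continuous; apply/derivable1_diffP.
    by have [] := dN s.
  split.
  + by move=> s _; have [] := dN s.
  + exact/cvg_at_right_filter/cN.
  + exact/cvg_at_left_filter/cN.
- by move=> s _; rewrite derive1E; have [_ ->] := dN s.
Qed.

Section Solution.
Variables (y0 y1 : R[i]) (g : R -> R[i]).

(** Position and velocity with data y (0) = y0, eps y' (0) = y1 and forcing g. The
    homogeneous solution with position 1 and velocity 0 at time 0 is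
    eps^2 impulse' + 2 alpha impulse, and its derivative is - beta^2 impulse. *)
Definition osc_pos (x : R) : R[i] :=
  (eps%:C ^+ 2 * y0) * impulse' x + (2 * alpha * y0 + eps%:C * y1) * impulse x
  + cintegral `]0, x[ (fun s => impulse (x - s) * g s).

Definition osc_vel (x : R) : R[i] :=
  - (beta%:C ^+ 2 * y0) * impulse x + (eps%:C * y1) * impulse' x
  + cintegral `]0, x[ (fun s => impulse' (x - s) * g s).

(** The two exponential integrals only combine into a convolution with the
    impulse response because their coefficients are opposite. *)
Lemma mild_oscillatorE (x : R) : 0 < x -> cintegrable `]0, x[ g ->
  \sum_(b : bool) cexp (x%:C * char_root b) *
    ((- (-1) ^+ b * (eps ^+ 2)%:C * char_root (~~ b) * y0
      + (-1) ^+ b * eps%:C * y1) / (2 * delta)) +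
  \sum_(b : bool) cintegral `[0, x]
    (fun s => cexp ((x - s)%:C * char_root b) * ((-1) ^+ b * g s / (2 * delta))) =
  osc_pos x.
Proof.
move=> x0 ig.
have mI : measurable (`]0, x[%classic : set (measurableTypeR R)) by [].
have cint b : cintegrable `]0, x[ (fun s => cexp ((x - s)%:C * char_root b) * g s).
  apply: (cintegrable_convolution (k := fun s => cexp (s%:C * char_root b))) => //.
  exact: is_cderive_continuous (is_cderive_cexp (char_root b)).
have intE b : cintegral `[0, x]
    (fun s => cexp ((x - s)%:C * char_root b) * ((-1) ^+ b * g s / (2 * delta))) =
    ((-1) ^+ b / (2 * delta)) *
    cintegral `]0, x[ (fun s => cexp ((x - s)%:C * char_root b) * g s).
  have -> : (fun s =>
        cexp ((x - s)%:C * char_root b) * ((-1) ^+ b * g s / (2 * delta))) =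
      (fun s =>
        ((-1) ^+ b / (2 * delta)) * (cexp ((x - s)%:C * char_root b) * g s)).
    by apply/funext => s; ring.
  by rewrite cintegral_itv_ccoo ?cintegralMl//; exact: cintegrableMl.
rewrite !big_bool !intE /osc_pos /=.
have -> : cintegral `]0, x[ (fun s => impulse (x - s) * g s) =
    (2 * delta)^-1 *
      cintegral `]0, x[ (fun s => cexp ((x - s)%:C * char_root false) * g s)
    + - (2 * delta)^-1 *
      cintegral `]0, x[ (fun s => cexp ((x - s)%:C * char_root true) * g s).
  rewrite -!cintegralMl// -cintegralD//; [|exact: cintegrableMl..].
  by apply: eq_cintegral => s _; rewrite /impulse; ring.
rewrite /impulse /impulse'.
set If := cintegral _ _; set It := cintegral _ _.
set Ef := cexp _; set Et := cexp _.
rewrite /char_root fmorphV rmorphXn /= expr0 expr1.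
by field; rewrite epsC0 delta0.
Qed.

Lemma is_cderive_osc_pos (T x : R) : x \in `]0, T[ -> cintegrable `]0, T[ g ->
  is_cderive osc_pos x (osc_vel x).
Proof.
move=> xT ig; rewrite /osc_pos /osc_vel; apply: is_cderiveD.
  have -> : - (beta%:C ^+ 2 * y0) * impulse x + eps%:C * y1 * impulse' x =
    (eps%:C ^+ 2 * y0) *
      (- eps%:C ^- 2 * (2 * alpha * impulse' x + beta%:C ^+ 2 * impulse x)) +
    (2 * alpha * y0 + eps%:C * y1) * impulse' x by field.
  apply: is_cderiveD; apply: is_cderiveMl.
    exact: is_cderive_impulse'.
  exact: is_cderive_impulse.
apply: (is_cderive_convolution xT) ig => //; first exact: impulse0.
exact: is_cderive_impulse.
Qed.

(** <(a, c), exp (t A) z> = <exp (t A^T) (a, c), z>, applied to the initial data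
    z = (beta y0, y1) and to the forcing z = (0, g / eps) at each time. *)
Lemma osc_duality (a c : R[i]) (x : R) : 0 < x -> cintegrable `]0, x[ g ->
  a * (beta%:C * osc_pos x) + c * (eps%:C * osc_vel x) =
  dual_pos a c x * (beta%:C * y0) + dual_vel a c x * y1 +
  cintegral `]0, x[ (fun s => eps%:C^-1 * dual_vel a c (x - s) * g s).
Proof.
move=> x0 ig.
have i1 : cintegrable `]0, x[ (fun s => impulse (x - s) * g s).
  exact: cintegrable_convolution.
have i2 : cintegrable `]0, x[ (fun s => impulse' (x - s) * g s).
  exact: cintegrable_convolution.
have mI : measurable (`]0, x[%classic : set (measurableTypeR R)) by [].
have -> : cintegral `]0, x[ (fun s => eps%:C^-1 * dual_vel a c (x - s) * g s) =
    (a * beta%:C) * cintegral `]0, x[ (fun s => impulse (x - s) * g s) +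
    (c * eps%:C) * cintegral `]0, x[ (fun s => impulse' (x - s) * g s).
  rewrite -!cintegralMl// -cintegralD//; [|exact: cintegrableMl..].
  by apply: eq_cintegral => s _; rewrite /dual_vel; field.
rewrite /osc_pos /osc_vel /dual_pos /dual_vel; ring.
Qed.

(** The constants involve neither eps nor beta nor the time: this is what allows
    the estimates of all the modes to be summed. *)
Lemma osc_energy_le (x : R) : 0 < x -> cintegrable `]0, x[ g ->
  mu.-integrable `]0, x[ (EFin \o (fun s => sqn (g s))) ->
  sqn (beta%:C * osc_pos x) + sqn (eps%:C * osc_vel x) <=
  4 * (sqn (beta%:C * y0) + sqn y1) +
  (2 * Re alpha)^-1 * \int[mu]_(s in `]0, x[) sqn (g s).
Proof.
move=> x0 ig ig2.
set zp := beta%:C * osc_pos x; set zv := eps%:C * osc_vel x.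
(* With these a and c the pairing of osc_duality is the energy itself. *)
pose a := zp^*; pose c := zv^*.
have [iP dissP] := dual_dissipation a c x0.
have := osc_duality a c x0 ig; rewrite -/zp -/zv => /(congr1 (fun z => Re z)).
have -> : Re (a * zp + c * zv) = sqn zp + sqn zv.
  by rewrite cReD !ReJM.
have a2 : sqn a + sqn c = sqn zp + sqn zv by rewrite !sqnJ.
rewrite a2 in dissP.
have fP : cintegrable `]0, x[ (fun s => eps%:C^-1 * dual_vel a c (x - s) * g s).
  have mI : measurable (`]0, x[%classic : set (measurableTypeR R)) by [].
  have -> : (fun s => eps%:C^-1 * dual_vel a c (x - s) * g s) =
      (fun s => eps%:C^-1 * (dual_vel a c (x - s) * g s)).
    by apply/funext => s; rewrite mulrA.
  apply: cintegrableMl => //; apply: cintegrable_convolution => //.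
  exact: is_cderive_continuous (is_cderive_dual_vel a c).
(* The weight 4 Re alpha in Young's inequality makes the adjoint term at most
   half of the energy, by dual_dissipation. *)
have young :
    Re (cintegral `]0, x[ (fun s => eps%:C^-1 * dual_vel a c (x - s) * g s)) <=
    2 * Re alpha / eps ^+ 2 * \int[mu]_(s in `]0, x[) sqn (dual_vel a c (x - s)) +
    (8 * Re alpha)^-1 * \int[mu]_(s in `]0, x[) sqn (g s).
  rewrite /cintegral /= -!RintegralZl// -RintegralD//; [|exact: integrableZl_EFin..].
  apply: le_Rintegral => //; first exact: fP.1.
    by apply: integrableD_EFin => //; exact: integrableZl_EFin.
  move=> s _; move: (dual_vel a c (x - s)) (g s) => p q.
  rewrite -fmorphV; case: p => p1 p2; case: q => q1 q2; rewrite /sqn /=.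
  set A := Re alpha; set e := eps^-1.
  have -> : eps ^- 2 = e ^+ 2 by rewrite exprVn.
  rewrite -subr_ge0.
  have -> : 2 * A * e ^+ 2 * (p1 ^+ 2 + p2 ^+ 2) + (8 * A)^-1 * (q1 ^+ 2 + q2 ^+ 2)
     - ((e * p1 - 0 * p2) * q1 - (e * p2 + 0 * p1) * q2) =
    (8 * A)^-1 * ((4 * A * e * p1 - q1) ^+ 2 + (4 * A * e * p2 + q2) ^+ 2).
    by field; rewrite gt_eqF.
  apply: mulr_ge0; first by rewrite invr_ge0 mulr_ge0// ltW.
  by rewrite addr_ge0 ?sqr_ge0.
set I := Re (cintegral _ _) in young *.
rewrite cReD -/I => En.
set J := \int[mu]_(s in _) sqn (dual_vel _ _ _) in dissP young.
set G := \int[mu]_(s in _) sqn (g s) in young *.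
have N0 : 0 <= dual_energy a c x by rewrite addr_ge0 ?sqn_ge0.
have Nle : dual_energy a c x <= sqn zp + sqn zv.
  rewrite -subr_ge0 -dissP; apply: mulr_ge0.
    by rewrite divr_ge0 ?sqr_ge0// mulr_ge0// ltW.
  by apply: Rintegral_ge0 => s _; exact: sqn_ge0.
(* Another quarter of the energy is spent on the initial data. *)
have data : Re (dual_pos a c x * (beta%:C * y0) + dual_vel a c x * y1) <=
    dual_energy a c x / 4 + (sqn (beta%:C * y0) + sqn y1).
  rewrite /dual_energy.
  move: (dual_pos a c x) (dual_vel a c x) (beta%:C * y0) y1.
  move=> [q1 q2] [p1 p2] [u1 u2] [v1 v2]; rewrite /sqn /= -subr_ge0.
  have -> : (q1 ^+ 2 + q2 ^+ 2 + (p1 ^+ 2 + p2 ^+ 2)) / 4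
      + (u1 ^+ 2 + u2 ^+ 2 + (v1 ^+ 2 + v2 ^+ 2))
      - (q1 * u1 - q2 * u2 + (p1 * v1 - p2 * v2)) =
    (q1 / 2 - u1) ^+ 2 + (q2 / 2 + u2) ^+ 2 +
    ((p1 / 2 - v1) ^+ 2 + (p2 / 2 + v2) ^+ 2) by field.
  by rewrite !addr_ge0 ?sqr_ge0.
set data0 := sqn _ + sqn _ in data *.
have dissP' : 2 * Re alpha / eps ^+ 2 * J =
    (sqn zp + sqn zv - dual_energy a c x) / 2.
  by rewrite -dissP; field.
have G8 : (2 * Re alpha)^-1 * G = 4 * ((8 * Re alpha)^-1 * G).
  by field; rewrite gt_eqF.
rewrite dissP' in young; rewrite G8.
set H := (8 * Re alpha)^-1 * G in young *.
lra.
Qed.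

End Solution.
End Oscillator.

(** * Sums and integrals of nonnegative functions *)

Section SumIntegral.
Local Open Scope ereal_scope.

Lemma esumZl_le (R : realType) (I : choiceType) (c : R) (a : I -> \bar R) :
  (0 <= c)%R -> (forall i, 0 <= a i) ->
  \esum_(i in [set: I]) (c%:E * a i) <= c%:E * \esum_(i in [set: I]) a i.
Proof.
move=> c0 a0; apply: ge_ereal_sup => /= _ [X [finX _] <-].
rewrite -ge0_mule_fsumr//; apply: lee_wpmul2l; first by rewrite lee_fin.
by apply: ereal_sup_ubound; exists X.
Qed.

(** The integral of a nonnegative function is a supremum over simple functions
    below it, so it is monotone for functions that need not be measurable. *)
Lemma ge0_le_integral_nonmeasurable d (T : measurableType d) (R : realType)
    (mu : {measure set T -> \bar R}) (D : set T) (f g : T -> \bar R) :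
  (forall x, D x -> 0 <= f x) -> (forall x, D x -> f x <= g x) ->
  \int[mu]_(x in D) f x <= \int[mu]_(x in D) g x.
Proof.
move=> f0 fg; have g0 x : D x -> 0 <= g x.
  by move=> Dx; apply: le_trans (fg _ Dx); exact: f0.
rewrite !ge0_integralE//; apply: le_ereal_sup => /= _ [h hf <-].
exists h => // x; apply: le_trans (hf x) _.
by rewrite !patchE; case: ifPn => // /set_mem Dx; exact: fg.
Qed.

(** The easy half of Tonelli's theorem, for an index set of any cardinality:
    exchange a finite sum with the integral, then let the finite set grow. *)
Lemma esum_integral_le d (T : measurableType d) (R : realType)
    (mu : {measure set T -> \bar R}) (D : set T) (I : choiceType)
    (w : I -> T -> \bar R) : measurable D ->
  (forall i, measurable_fun D (w i)) -> (forall i x, 0 <= w i x) ->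
  \esum_(i in [set: I]) \int[mu]_(x in D) w i x <=
  \int[mu]_(x in D) \esum_(i in [set: I]) w i x.
Proof.
move=> mD mw w0; apply: ge_ereal_sup => /= _ [X [finX _] <-].
rewrite -ge0_integral_fsum//; apply: ge0_le_integral_nonmeasurable => x _.
  exact: fsume_ge0.
by apply: ereal_sup_ubound; exists X.
Qed.

End SumIntegral.

(** * From modes to Sobolev norms *)

Section Sobolev.
Variables (R : realType) (d : nat).
Notation mu := (@lebesgue_measure R).

Lemma bracket_gt0 (k : 'rV[int]_d) : 0 < bracket R k.
Proof.
by rewrite sqrtr_gt0 ltr_pwDl// sumr_ge0// => j _; rewrite sqr_ge0.
Qed.

Lemma bracket_powR (s : R) (k : 'rV[int]_d) :
  bracket R k `^ (2 * (s - 1)) * bracket R k ^+ 2 = bracket R k `^ (2 * s).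
Proof.
rewrite -powR_mulrn ?ltW ?bracket_gt0// -powRD; last first.
  by rewrite (gt_eqF (bracket_gt0 k)) implybT.
by congr (_ `^ _); ring.
Qed.

(** The square of the H^s norm, as a function of the Fourier coefficients. *)
Definition sobolev_sum (s : R) (c : 'rV[int]_d -> R[i]) : \bar R :=
  \esum_(k in [set: 'rV[int]_d]) (bracket R k `^ (2 * s) * sqn (c k))%:E.

Lemma sobolev_sum_ge0 s c : (0 <= sobolev_sum s c)%E.
Proof.
by apply: esum_ge0 => k _; rewrite lee_fin mulr_ge0 ?powR_ge0 ?sqn_ge0.
Qed.

Lemma sobolev_normE s u : sobolev_norm s u = sqrte (sobolev_sum s (fourier u)).
Proof.
by rewrite /sobolev_norm /sobolev_sum; under eq_esum do rewrite sqr_normc.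
Qed.

Lemma sobolev_norm_sqr s (u : torus_pairing R d) :
  (sobolev_norm s u ^+ 2)%E = sobolev_sum s (fourier u).
Proof. by rewrite sobolev_normE sqr_sqrte// sobolev_sum_ge0. Qed.

Lemma L2_time_normE (T s : R) (f : R -> torus_pairing R d) :
  time_norm 2%:E T (fun t => sobolev_norm s (f t)) =
  sqrte (\int[mu]_(t in `]0%R, T[) sobolev_sum s (fourier (f t)))%E.
Proof.
rewrite /time_norm unlock poweR12_sqrt; last first.
  by apply: integral_ge0 => x _; exact: poweR_ge0.
congr sqrte; rewrite [RHS]integral_mkcond; apply: eq_integral => t _.
rewrite !patchE; case: ifPn => _; last by rewrite abse0 poweR0r.
rewrite sobolev_normE -poweR12_sqrt ?sobolev_sum_ge0// gee0_abs ?poweR_ge0//.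
by rewrite -poweRrM mulVf// poweRe1// sobolev_sum_ge0.
Qed.

Lemma Linf_time_norm_le (T : R) (h : R -> \bar R) (M : \bar R) :
  (0 <= M)%E -> (forall t, t \in `]0, T[ -> (`|h t| <= M)%E) ->
  (time_norm +oo T h <= M)%E.
Proof.
move=> M0 hM; rewrite /time_norm unlock; case: ifP => // _.
apply/ess_supP; apply: nearW => t /=; rewrite patchE.
by case: ifPn => [/set_mem|_]; [exact: hM | rewrite abse0].
Qed.

(** The imaginary part 2 Re(alpha) Im(alpha) of the discriminant does not depend
    on the frequency. *)
Lemma disc_neq0 (alpha : R[i]) (eps : R) (k : 'rV[int]_d) :
  admissible alpha -> disc alpha eps k != 0.
Proof.
move=> [a0 b0]; rewrite /disc sqrtc_eq0; apply/eqP => /(congr1 (fun z => Im z)).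
rewrite expr2; case: alpha a0 b0 => a b /= a0 b0 /eqP.
rewrite oppr0 addr0 (_ : a * b + b * a = 2 * (a * b)); last by ring.
by rewrite !mulf_eq0 pnatr_eq0 (gt_eqF a0) (negbTE b0).
Qed.

Lemma disc_sqr (alpha : R[i]) (eps : R) (k : 'rV[int]_d) :
  disc alpha eps k ^+ 2 = alpha ^+ 2 - (eps ^+ 2 * bracket R k ^+ 2)%:C.
Proof. exact: sqr_sqrtc. Qed.

Lemma sobolev_sum_ge s (c : 'rV[int]_d -> R[i]) k :
  ((bracket R k `^ (2 * s) * sqn (c k))%:E <= sobolev_sum s c)%E.
Proof.
apply: esum_ge; exists [set k]; first by split; [exact: finite_set1 | by []].
by rewrite fsbig_set1.
Qed.

Lemma measurable_sqn (g : R -> R[i]) (D : set R) :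
  cmeasurable D g -> measurable_fun D (fun t => sqn (g t)).
Proof.
by move=> [g1 g2]; apply: measurable_funD; apply: measurable_funX.
Qed.

(** A single weighted coefficient is dominated by the whole Sobolev sum; on a
    bounded interval, square integrable functions are integrable. *)
Lemma L2_sobolev_mode (s T : R) (f : R -> torus_pairing R d) k :
  L2_sobolev s T f ->
  mu.-integrable `]0, T[ (EFin \o (fun t => sqn (fourier (f t) k))) /\
  cintegrable `]0, T[ (fun t => fourier (f t) k).
Proof.
move=> [_ mf]; rewrite L2_time_normE => Sfin.
have b0 : 0 < bracket R k `^ (2 * s) by rewrite powR_gt0 ?bracket_gt0.
have [m1 m2] := mf k; have msq := measurable_sqn (mf k).
have mI : measurable (`]0, T[%classic : set (measurableTypeR R)) by [].
have iw : mu.-integrable `]0, T[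
    (EFin \o (fun t => bracket R k `^ (2 * s) * sqn (fourier (f t) k))).
  apply/integrableP; split.
    by apply/measurable_EFinP; apply: measurable_funM.
  apply: (@le_lt_trans _ _
    (\int[mu]_(t in `]0%R, T[) sobolev_sum s (fourier (f t)))%E).
    apply: ge0_le_integral_nonmeasurable => t _; first exact: abse_ge0.
    rewrite gee0_abs ?sobolev_sum_ge//.
    by rewrite lee_fin mulr_ge0 ?sqn_ge0// ltW.
  rewrite ltey; apply/eqP => SE; move: Sfin.
  by rewrite SE.
have isq : mu.-integrable `]0, T[ (EFin \o (fun t => sqn (fourier (f t) k))).
  have := integrableZl_EFin mI (bracket R k `^ (2 * s))^-1 iw.
  congr (mu.-integrable _ (EFin \o _)); apply/funext => t.
  by rewrite mulKf ?gt_eqF.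
split => //.
have i1 : mu.-integrable `]0, T[ (EFin \o (fun t => 1 + sqn (fourier (f t) k))).
  apply: integrableD_EFin => //.
  apply: measurable_bounded_integrable => //; last exact: bounded_cst.
  by rewrite /= lebesgue_measure_itv /=; case: ifP => _; rewrite ?ltry.
have dom (h : R -> R) : measurable_fun `]0, T[ h ->
    (forall t, `|h t| <= 1 + sqn (fourier (f t) k)) ->
    mu.-integrable `]0, T[ (EFin \o h).
  move=> mh hle; apply: le_integrable i1 => //; first exact/measurable_EFinP.
  move=> t _ /=; rewrite lee_fin [leRHS]ger0_norm//.
  by apply: addr_ge0 => //; exact: sqn_ge0.
split; apply: dom => // t; rewrite /sqn; case: (fourier _ _) => a b /=;
  by rewrite ler_norml; apply/andP; split; nra.
Qed.

Section MildSolution.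
Variables (alpha : R[i]) (eps T sg : R) (phi0 phi1 : torus_pairing R d).
Variables (f u : R -> torus_pairing R d).
Hypothesis adm : admissible alpha.
Hypothesis eps0 : 0 < eps.
Hypothesis fL2 : L2_sobolev (sg - 1) T f.
Hypothesis mild : mild_solution alpha eps T phi0 phi1 f u.

Lemma mild_mode_energy (t : R) (k : 'rV[int]_d) : t \in `]0, T[ ->
  exists w : R[i], is_cderive (fun r => fourier (u r) k) t w /\
    sqn ((bracket R k)%:C * fourier (u t) k) + sqn (eps%:C * w) <=
    4 * (sqn ((bracket R k)%:C * fourier phi0 k) + sqn (fourier phi1 k)) +
    (2 * Re alpha)^-1 * \int[mu]_(r in `]0, T[) sqn (fourier (f r) k).
Proof.
move=> tT; have [a0 _] := adm.
have D0 := disc_neq0 eps k adm; have D2 := disc_sqr alpha eps k.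
have [ig2 ig] := L2_sobolev_mode k fL2.
have subT (x : R) : x \in `]0, T[ -> `]0, x[ `<=` `]0, T[.
  rewrite in_itv /= => /andP[_ xT].
  by apply: subset_itvl; rewrite bnd_simp ltW.
have pos (x : R) : x \in `]0, T[ -> 0 < x by rewrite in_itv /= => /andP[].
have igx (x : R) : x \in `]0, T[ ->
    cintegrable `]0, x[ (fun r => fourier (f r) k).
  by move=> xT; apply: cintegrableS ig => //; exact: subT.
pose y := osc_pos alpha eps (disc alpha eps k) (fourier phi0 k) (fourier phi1 k)
  (fun r => fourier (f r) k).
pose v := osc_vel alpha eps (bracket R k) (disc alpha eps k)
  (fourier phi0 k) (fourier phi1 k) (fun r => fourier (f r) k).
have yE (x : R) : x \in `]0, T[ -> y x = fourier (u x) k.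
  move=> xT; have x0 := pos _ xT.
  have xT' : x \in `[0, T] by exact: subset_itv_oo_cc xT.
  have [_ ->] := mild xT'.
  exact/esym/(mild_oscillatorE alpha eps0 D0 _ _ x0 (igx _ xT)).
exists (v t); split.
  apply: (near_eq_is_cderive (f := y)).
    by apply: filterS yE _; exact: near_in_itvoo.
  exact: (is_cderive_osc_pos eps0 D0 D2 _ _ tT ig).
have ig2t : mu.-integrable `]0, t[ (EFin \o (fun r => sqn (fourier (f r) k))).
  by apply: integrableS ig2 => //; exact: subT.
rewrite -yE//; apply: le_trans
  (osc_energy_le a0 eps0 D0 D2 _ _ (pos _ tT) (igx _ tT) ig2t) _.
rewrite lerD2l; apply: ler_wpM2l; first by rewrite invr_ge0 mulr_ge0 ?ltW.
rewrite -lee_fin /Rintegral !fineK; try exact: integrable_fin_num.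
apply: ge0_subset_integral => //; first exact: measurable_int ig2.
  by move=> r _; rewrite lee_fin sqn_ge0.
exact: subT.
Qed.

Lemma mild_energy_sum (t : R) : t \in `]0, T[ ->
  (sobolev_sum sg (fourier (u t)) +
   sobolev_sum (sg - 1)
     (fun k => eps%:C * cderive (fun r => fourier (u r) k) t)%R <=
   4%:E * sobolev_sum sg (fourier phi0) +
   4%:E * sobolev_sum (sg - 1) (fourier phi1) +
   ((2 * Re alpha)^-1)%:E *
     \int[mu]_(r in `]0%R, T[) sobolev_sum (sg - 1) (fourier (f r)))%E.
Proof.
move=> tT; have [a0 _] := adm.
have c0 : 0 <= (2 * Re alpha)^-1 by rewrite invr_ge0 mulr_ge0 ?ltW.
have p0 r (k : 'rV[int]_d) : 0 <= bracket R k `^ r by exact: powR_ge0.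
have t0 r (c : 'rV[int]_d -> R[i]) k : (0 <= (bracket R k `^ r * sqn (c k))%:E)%E.
  by rewrite lee_fin mulr_ge0 ?sqn_ge0.
rewrite /sobolev_sum -esumD; [|by move=> k _; exact: t0|]; last first.
  by move=> k _; rewrite lee_fin mulr_ge0 ?sqn_ge0.
pose w k r := (bracket R k `^ (2 * (sg - 1)) * sqn (fourier (f r) k))%:E.
have mw k : measurable_fun `]0, T[ (w k).
  apply/measurable_EFinP; apply: measurable_funM => //; apply: measurable_sqn.
  by have [_ mf _] := fL2; exact: mf.
have w0 k r : (0 <= w k r)%E by exact: t0.
apply: (@le_trans _ _ (\esum_(k in [set: 'rV[int]_d])
  (4%:E * (bracket R k `^ (2 * sg) * sqn (fourier phi0 k))%:E +
   4%:E * (bracket R k `^ (2 * (sg - 1)) * sqn (fourier phi1 k))%:E +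
   ((2 * Re alpha)^-1)%:E * \int[mu]_(r in `]0%R, T[) w k r))%E).
  apply: le_esum => k _.
  have [v [dv ev]] := mild_mode_energy k tT.
  have [_ ->] := cderiveE dv.
  have [ig2 _] := L2_sobolev_mode k fL2.
  have -> : (\int[mu]_(r in `]0%R, T[) w k r = (bracket R k `^ (2 * (sg - 1)) *
      \int[mu]_(r in `]0, T[) sqn (fourier (f r) k))%:E)%E.
    rewrite -RintegralZl// /Rintegral fineK//.
    apply: integrable_fin_num => //.
    exact: integrableZl_EFin.
  rewrite -!EFinM -!EFinD lee_fin.
  rewrite -(bracket_powR sg) -sqn_real -!mulrA -!sqnM.
  have := ler_wpM2l (p0 (2 * (sg - 1)) k) ev.
  set b := bracket R k `^ _; set I := \int[mu]_(_ in _) _; nra.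
have e0 r (c : 'rV[int]_d -> R[i]) k :
    (0 <= 4%:E * (bracket R k `^ r * sqn (c k))%:E)%E.
  by rewrite mule_ge0.
have I0 k : (0 <= \int[mu]_(r in `]0%R, T[) w k r)%E by exact: integral_ge0.
rewrite !esumD//; last 2 first.
  by move=> k _; rewrite adde_ge0.
  by move=> k _; rewrite mule_ge0.
apply: leeD; first apply: leeD.
- exact: esumZl_le.
- exact: esumZl_le.
apply: le_trans (esumZl_le c0 I0) _; apply: lee_wpmul2l; first by rewrite lee_fin.
exact: esum_integral_le.
Qed.

End MildSolution.
End Sobolev.

Theorem theorem1 (R : realType) (d : nat) (hd : (0 < d)%N) (sigma : R) :
  exists C : R[i] -> R,
    locally_bounded_on (@admissible R) C /\
    forall (alpha : R[i]) (eps T : R) (phi0 phi1 : torus_pairing R d)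
      (f u : R -> torus_pairing R d),
      admissible alpha -> 0 < eps <= 1 -> 0 < T ->
      sobolev sigma phi0 -> sobolev (sigma - 1) phi1 ->
      L2_sobolev (sigma - 1) T f ->
      mild_solution alpha eps T phi0 phi1 f u ->
      (forall (k : 'rV[int]_d) (t : R), t \in `]0, T[ ->
         cderivable (fun s => fourier (u s) k) t) /\
      (time_norm +oo T
         (fun t => energy_norm sigma (u t)
                     (fun psi => (eps%:C * time_derivative u t psi)%R))
       <= (C alpha)%:E *
          (sobolev_norm sigma phi0 + sobolev_norm (sigma - 1) phi1 +
           time_norm 2%:E T (fun t => sobolev_norm (sigma - 1) (f t))))%E.
Proof.
exists (fun alpha => 2 + (Re alpha)^-1); split.
  (* On the disc of radius Re a / 2 about a, the real part exceeds Re a / 2. *)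
  move=> a [a0 _]; exists (Re a / 2), (2 + 2 / Re a).
  split; first by rewrite divr_gt0.
  move=> b [b0 _] ba.
  have hb : Re a / 2 < Re b.
    have : `|Re (b - a)| <= Normc.normc (b - a).
      case: (b - a) => x y /=; rewrite -sqrtr_sqr ler_sqrt ?lerDl ?sqr_ge0//.
      by rewrite addr_ge0 ?sqr_ge0.
    have -> : Re (b - a) = Re b - Re a by case: a b {a0 b0 ba} => ? ? [? ?].
    rewrite ler_norml => /andP[+ _]; lra.
  rewrite ger0_norm; last by rewrite addr_ge0// invr_ge0 ltW.
  rewrite lerD2l; rewrite -(invf_div (Re a)) lef_pV2 ?posrE ?divr_gt0//.
  exact: ltW.
move=> alpha eps T phi0 phi1 f u adm /andP[eps0 _] T0 [_ H0] [_ H1] fL2 mild.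
split.
  move=> k t tT; have [w [dw _]] := mild_mode_energy adm eps0 fL2 mild k tT.
  by have [] := cderiveE dw.
have [a0 _] := adm.
have [_ _ HF] := fL2.
have fin (x : \bar R) : (0 <= x)%E -> (sqrte x < +oo)%E ->
    exists2 r : R, 0 <= r & sqrte x = r%:E /\ x = (r ^+ 2)%:E.
  move=> x0 xlt; have fx : sqrte x \is a fin_num.
    by rewrite ge0_fin_numE ?sqrte_ge0.
  exists (fine (sqrte x)); first by rewrite fine_ge0 ?sqrte_ge0.
  by rewrite EFin_expe fineK// sqr_sqrte.
have IF0 : (0 <= \int[lebesgue_measure]_(r in `]0%R, T[)
    sobolev_sum (sigma - 1) (fourier (f r)))%E.
  by apply: integral_ge0 => t _; exact: sobolev_sum_ge0.
rewrite L2_time_normE in HF *; rewrite !sobolev_normE in H0 H1 *.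
have [x x0 [sx xE]] := fin _ (sobolev_sum_ge0 _ _) H0.
have [y y0 [sy yE]] := fin _ (sobolev_sum_ge0 _ _) H1.
have [z z0 [sz zE]] := fin _ IF0 HF.
rewrite sx sy sz -!EFinD -EFinM.
set C := 2 + _; have C0 : 0 < C by rewrite addr_gt0// invr_gt0.
have rhs0 : 0 <= C * (x + y + z).
  by apply: mulr_ge0; [exact: ltW | rewrite !addr_ge0].
apply: Linf_time_norm_le => [|t tT]; first by rewrite lee_fin.
rewrite gee0_abs ?sqrte_ge0//.
rewrite -[leRHS]gee0_abs ?lee_fin// -sqrte_sqr lee_sqrt; last first.
  by rewrite -EFin_expe lee_fin sqr_ge0.
rewrite !sobolev_norm_sqr.
apply: le_trans (mild_energy_sum adm eps0 fL2 mild tT) _.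
rewrite xE yE zE -EFin_expe -!EFinM -!EFinD lee_fin.
(* The square of C dominates both coefficients of the mode estimate, 4 and q. *)
set q := (2 * Re alpha)^-1.
have qE : (Re alpha)^-1 = 2 * q by rewrite /q; field; rewrite gt_eqF.
have q0 : 0 < q by rewrite invr_gt0 mulr_gt0.
rewrite /C qE exprMn; set c := (2 + 2 * q) ^+ 2.
have c4 : 4 <= c by rewrite /c; nra.
have cq : q <= c by rewrite /c; nra.
have sq : x ^+ 2 + y ^+ 2 + z ^+ 2 <= (x + y + z) ^+ 2.
  by have := mulr_ge0 x0 y0; have := mulr_ge0 x0 z0; have := mulr_ge0 y0 z0; nra.
have cx := ler_wpM2r (sqr_ge0 x) c4; have cy := ler_wpM2r (sqr_ge0 y) c4.
have cz := ler_wpM2r (sqr_ge0 z) cq.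
have csq := ler_wpM2l (le_trans (ltW q0) cq) sq.
by rewrite !mulrDr in csq; lra.
Qed.
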